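(* Let $(G_n)_{n\ge 2}$ be a sequence of random graphs following the linear de-preferential attachment model with $m=1$, and let $i\ge 1$ be fixed. Then, as $n\to\infty$, $$\frac{d_i(n)-\log n}{\sqrt{\log n}}\longrightarrow N(0,1)\quad\text{in distribution.}$$
   Context: Linear de-preferential attachment model with $m=1$: the graph $G_n$ has vertices $v_1,\dots,v_n$, and $d_i(n)$ denotes the degree of $v_i$ in $G_n$ (all incident edges and half-edges counted). The process starts from $G_2$, consisting of two vertices $v_1,v_2$ joined by an edge together with one extra ''free'' edge (half-edge) attached to one of the two vertices, which counts toward that vertex's degree; thus the degrees in $G_2$ are $1$ and $2$, and the degrees in $G_n$ sum to $2n-1$. Given $G_n$, a new vertex $v_{n+1}$ is added with a single edge $e_{n+1}$ joining it to one of $v_1,\dots,v_n$. With $\mathscr{F}_n$ the natural filtration of the process, $$P(e_{n+1}=\{v_{n+1},v_i\}\mid \mathscr{F}_n)=\frac{1}{n-1}\left(1-\frac{d_i(n)}{2n-1}\right),\qquad i=1,\dots,n.$$ Thus the chosen vertex's degree increases by one and $d_{n+1}(n+1)=1$. *)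

(* Defs.v *)
From HB Require Import structures.
From mathcomp Require Export all_boot all_order all_algebra.
From mathcomp Require Export all_classical all_reals all_analysis.

Set Implicit Arguments.
Unset Strict Implicit.
Unset Printing Implicit Defensive.

Import Order.TTheory GRing.Theory Num.Theory.
Import numFieldNormedType.Exports.

Local Open Scope classical_set_scope.
Local Open Scope ring_scope.

(* A finite multigraph on the vertices v_1, ..., v_nverts, each v_i being
   represented by the natural number i. An edge is given by its two ends (the
   order of the ends is irrelevant to degrees); a half-edge by its only end. *)
Record hgraph := HGraph {
  nverts : nat;
  edges : seq (nat * nat);
  half_edges : seq nat
}.

HB.instance Definition _ := gen_eqMixin hgraph.
HB.instance Definition _ := gen_choiceMixin hgraph.
HB.instance Definition _ := isPointed.Build hgraph (HGraph 0 [::] [::]).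
HB.instance Definition _ := @isMeasurable.Build default_measure_display
  hgraph discrete_measurable discrete_measurable0
  discrete_measurableC discrete_measurableU.

(* A loop would contribute 2. *)
Definition degree (i : nat) (g : hgraph) : nat :=
  (\sum_(e <- edges g) ((e.1 == i) + (e.2 == i)) + count_mem i (half_edges g))%N.

Definition initial_graph (h : nat) : hgraph := HGraph 2 [:: (2%N, 1%N)] [:: h].

Definition attach (i : nat) (g : hgraph) : hgraph :=
  HGraph (nverts g).+1 (rcons (edges g) ((nverts g).+1, i)) (half_edges g).

Section conditional_probability.
Context d (T : measurableType d) (R : realType) (P : probability T R).

(* [q] is a version of the conditional probability P(A | F), where [F] is a
   sub-sigma-algebra of the measurable sets. *)
Definition is_cond_prob (F : set (set T)) (A : set T) (q : T -> R) : Prop :=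
  [/\ forall Y : set R, measurable Y -> F (q @^-1` Y),
      P.-integrable [set: T] (EFin \o q) &
      forall B, F B -> P (A `&` B) = (\int[P]_(w in B) (q w)%:E)%E].

End conditional_probability.

Section depreferential_attachment.
Context d (T : measurableType d) (R : realType) (P : probability T R).

(* Indices start at 2: G 0 and G 1 are not part of the process. *)
Definition natural_filtration (G : nat -> {RV P >-> hgraph}) (n : nat) :
    set (set T) :=
  <<s \bigcup_(k in [set k | (2 <= k <= n)%N])
        g_sigma_algebra_preimage (G k) >>.

Definition attach_event (G : nat -> {RV P >-> hgraph}) (n i : nat) : set T :=
  [set w | G n.+1 w = attach i (G n w)].

Record linear_depreferential_attachment (G : nat -> {RV P >-> hgraph}) :
    Prop := {
  ldpa_init :
    {ae P, forall w, G 2%N w = initial_graph 1 \/ G 2%N w = initial_graph 2};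
  ldpa_step : forall n, (2 <= n)%N ->
    {ae P, forall w, exists2 i, (1 <= i <= n)%N & attach_event G n i w};
  ldpa_prob : forall n i, (2 <= n)%N -> (1 <= i <= n)%N ->
    is_cond_prob P (natural_filtration G n) (attach_event G n i)
      (fun w => 1 / (n%:R - 1) * (1 - (degree i (G n w))%:R / (2 * n%:R - 1)))
}.

End depreferential_attachment.

Section convergence_in_distribution.
Context d (T : measurableType d) (R : realType) (P : probability T R).

Definition cvg_in_distribution (X : nat -> {RV P >-> R})
    (nu : probability (measurableTypeR R) R) : Prop :=
  forall x : R, {for x, continuous (fun y : R => nu [set` `]-oo, y]])} ->
    cdf (X n) x @[n --> \oo] --> nu [set` `]-oo, x]].

End convergence_in_distribution.

Section normalized_degree.
Context (R : realType) (i n : nat).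

Definition normalized_degree (g : hgraph) : R :=
  ((degree i g)%:R - ln n%:R) / Num.sqrt (ln n%:R).

Let measurable_normalized_degree : measurable_fun setT normalized_degree.
Proof. by []. Qed.

HB.instance Definition _ :=
  isMeasurableFun.Build _ _ hgraph R normalized_degree
    measurable_normalized_degree.

End normalized_degree.

(* Main.v *)
From HB Require Import structures.
Require Import Defs.
From mathcomp Require Import ring lra zify.

(* Lindeberg's replacement argument with the heat kernel itself as test
   function. Write D for the degree of v_i, L = ln N, and let
   heat t b = Phi (b / sqrt t), which solves the heat equation. From time n to
   n + 1 advance the "clock" ln n by r = ln (n + 1) - ln n: a Taylor expansion
   shows that the expectation of
     heat ((1 + s^2) L - ln n) (x sqrt L + ln n - D)
   changes by O(r / (s^2 L)^(3/2)) plus O((1 + E D) / (n^2 s sqrt L)), since D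
   jumps with probability r + O((1 + D) / n^2) and heat cancels the leading
   terms. These errors sum to O(1 / sqrt L). Comparing a fixed initial time with
   time N gives E Phi ((x - W) / s) -> Phi (x / sqrt (1 + s^2)), where
   W = (D - L) / sqrt L at time N; letting s -> 0 yields the convergence of
   P (W <= x). Only the one-dimensional marginals of the process enter, through
   the recursion they satisfy. *)

Set Implicit Arguments.
Unset Strict Implicit.
Unset Printing Implicit Defensive.

Import Order.TTheory GRing.Theory Num.Theory.
Import numFieldNormedType.Exports.

Local Open Scope classical_set_scope.
Local Open Scope ring_scope.

(** * Mean value estimates and the standard normal distribution *)

Section mean_value.
Context (R : realType).
Implicit Types (f df ddf dddf : R -> R) (a b x y M : R).

Lemma is_derive_le_bound f df a b M : a <= b ->
  (forall x, a <= x <= b -> is_derive x 1 f (df x)) ->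
  (forall x, a <= x <= b -> `|df x| <= M) -> `|f b - f a| <= M * (b - a).
Proof.
move=> ab fdf dfM.
have [||c cab ->] := @MVT_segment R f df a b ab.
- by move=> y; rewrite in_itv/= => /andP[/ltW ay /ltW yb]; apply: fdf; rewrite ay.
- apply: derivable_within_continuous => y; rewrite in_itv/= => /fdf fy.
  exact: ex_derive.
rewrite normrM (@ger0_norm _ (b - a)) ?subr_ge0//.
by apply: ler_wpM2r; rewrite ?subr_ge0// dfM.
Qed.

Lemma is_derive_affine (x c e : R) : is_derive x 1 (fun t : R => e + c * t) c.
Proof.
have h := is_deriveD (is_derive_cst e x 1) (is_deriveZ c (is_derive_id x (1 : R))).
by apply: (is_derive_eq h); rewrite add0r /GRing.scale/= mulr1.
Qed.

(** The expansion is about the right end [b]: in [heat_drift] the derivatives must be taken at time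
    [s - r], where the jump in [heat_step] is expanded. *)
Lemma taylor1_bound f df ddf b M : 0 <= b -> 0 <= M ->
  (forall x, 0 <= x <= b -> is_derive x 1 f (df x)) ->
  (forall x, 0 <= x <= b -> is_derive x 1 df (ddf x)) ->
  (forall x, 0 <= x <= b -> `|ddf x| <= M) ->
  `|f b - f 0 - b * df b| <= M * b ^+ 2.
Proof.
move=> b0 M0 fdf dfddf ddfM.
have h x : 0 <= x <= b ->
    is_derive x 1 (fun t => f t - (0 + df b * t)) (df x - df b).
  by move=> xb; exact: is_deriveB (fdf _ xb) (is_derive_affine _ _ _).
have hM x : 0 <= x <= b -> `|df x - df b| <= M * b.
  move=> /andP[x0 xb]; rewrite distrC.
  apply: (@le_trans _ _ (M * (b - x))).
    apply: (@is_derive_le_bound df ddf x b) => //.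
      by move=> y /andP[xy yb]; apply: dfddf; rewrite yb (le_trans x0).
    by move=> y /andP[xy yb]; apply: ddfM; rewrite yb (le_trans x0).
  by apply: ler_wpM2l => //; lra.
have := is_derive_le_bound b0 h hM.
by congr (`|_| <= _); ring.
Qed.

(** Three nested mean value estimates; bounding every increment of the variable by 1 gives [M]
    instead of the sharp [M / 6]. *)
Lemma taylor2_bound f df ddf dddf M : 0 <= M ->
  (forall x, 0 <= x <= 1 -> is_derive x 1 f (df x)) ->
  (forall x, 0 <= x <= 1 -> is_derive x 1 df (ddf x)) ->
  (forall x, 0 <= x <= 1 -> is_derive x 1 ddf (dddf x)) ->
  (forall x, 0 <= x <= 1 -> `|dddf x| <= M) ->
  `|f 1 - f 0 - df 0 - ddf 0 / 2| <= M.
Proof.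
move=> M0 fdf dfddf ddfd dddfM.
have dd x : 0 <= x <= 1 -> `|ddf x - ddf 0| <= M.
  move=> /andP[x0 x1]; apply: (@le_trans _ _ (M * (x - 0))).
    apply: (@is_derive_le_bound ddf dddf) => //.
      by move=> y /andP[y0 yx]; apply: ddfd; rewrite y0 (le_trans yx).
    by move=> y /andP[y0 yx]; apply: dddfM; rewrite y0 (le_trans yx).
  by rewrite subr0 ler_piMr.
have d x : 0 <= x <= 1 -> `|df x - (df 0 + ddf 0 * x)| <= M.
  move=> /andP[x0 x1].
  have h y : 0 <= y <= x ->
      is_derive y 1 (fun t => df t - (df 0 + ddf 0 * t)) (ddf y - ddf 0).
    move=> /andP[y0 yx]; apply: is_deriveB (dfddf _ _) (is_derive_affine _ _ _).
    by rewrite y0 (le_trans yx).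
  have hM y : 0 <= y <= x -> `|ddf y - ddf 0| <= M.
    by move=> /andP[y0 yx]; apply: dd; rewrite y0 (le_trans yx).
  have := is_derive_le_bound x0 h hM.
  rewrite mulr0 addr0 subrr !subr0 => /le_trans; apply.
  by rewrite ler_piMr.
have sq x : is_derive x 1 (fun t : R => df 0 * t + ddf 0 / 2 * t ^+ 2)
    (df 0 + ddf 0 * x).
  have h1 := is_deriveZ (df 0) (is_derive_id x (1 : R)).
  have h2 := is_deriveZ (ddf 0 / 2) (is_deriveX 2 (is_derive_id x (1 : R))).
  apply: (is_derive_eq (is_deriveD h1 h2)).
  by rewrite /GRing.scale/= !mulr1 expr1 -mulrA (mulrA 2^-1) mulVf ?mul1r.
have h x : 0 <= x <= 1 -> is_derive x 1
    (fun t => f t - (df 0 * t + ddf 0 / 2 * t ^+ 2))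
    (df x - (df 0 + ddf 0 * x)).
  by move=> xb; exact: is_deriveB (fdf _ xb) (sq _).
have := is_derive_le_bound ler01 h d; rewrite subr0 mulr1.
by congr (`|_| <= _) => /=; field.
Qed.

End mean_value.

(** * The standard normal density and distribution function *)

Section standard_normal.
Context (R : realType).
Implicit Types x : R.

Definition std_pdf (x : R) : R := normal_pdf 0 1 x.

Definition std_cdf (x : R) : R := fine (normal_prob (0 : R) 1 `]-oo, x]).

Lemma std_pdfE x : std_pdf x = normal_peak 1 * expR (- (x ^+ 2 / 2)).
Proof.
by rewrite /std_pdf normal_pdfE ?oner_neq0// /normal_fun subr0 expr1n mulNr.
Qed.

Lemma std_pdf_ge0 x : 0 <= std_pdf x.
Proof. exact: normal_pdf_ge0. Qed.

Lemma normal_peak1_le1 : normal_peak (1 : R) <= 1.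
Proof.
rewrite /normal_peak invf_le1 ?sqrtr_gt0; last first.
  by rewrite expr1n mul1r pmulrn_lgt0// pi_gt0.
rewrite -[leLHS]sqrtr1 ler_wsqrtr// expr1n mul1r.
by have := pi_ge2 R; rewrite mulr2n; lra.
Qed.

(** With u = x^2 / 2, 8 + x^4 = 8 (1 + u^2 / 2) <= 8 exp u, and the peak is at most 1. This decay
    absorbs the polynomial factors in the derivatives of the heat kernel. *)
Lemma std_pdf_decay x : std_pdf x * (8 + x ^+ 4) <= 8.
Proof.
rewrite std_pdfE expRN.
have h : (1 + (x ^+ 2 / 2) ^+ 2 / 2) <= expR (x ^+ 2 / 2).
  have := @expR_ge1Dxn R (x ^+ 2 / 2) 1.
  by rewrite /= (_ : 2`! = 2)%N//; apply; rewrite divr_ge0// sqr_ge0.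
have e0 : 0 < expR (x ^+ 2 / 2) by exact: expR_gt0.
rewrite -mulrA mulrC; apply: (@le_trans _ _ (8 * normal_peak 1)); last first.
  by have := normal_peak1_le1; lra.
apply: ler_wpM2r; first exact: normal_peak_ge0.
rewrite mulrC ler_pdivrMr//.
have -> : 8 + x ^+ 4 = 8 * (1 + (x ^+ 2 / 2) ^+ 2 / 2) by field.
lra.
Qed.

Lemma is_derive_std_pdf x : is_derive x 1 std_pdf (- x * std_pdf x).
Proof.
have -> : std_pdf = (fun t => normal_peak 1 * expR (- (t ^+ 2 / 2))).
  by apply/funext => t; rewrite std_pdfE.
have h1 : is_derive x 1 (fun t : R => - (t ^+ 2 / 2)) (- x).
  have h := is_deriveN (is_deriveZ (2^-1 : R) (is_deriveX 2 (is_derive_id x (1 : R)))).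
  have -> : (fun t : R => - (t ^+ 2 / 2)) = - (2^-1 \*: id ^+ 2).
    by apply/funext => t; rewrite /= mulrC.
  apply: (is_derive_eq h).
  by rewrite /GRing.scale/= mulr1 expr1 mulrA mulVf ?mul1r.
have h2 := is_deriveZ (normal_peak 1) (is_derive1_comp (is_derive_expR _) h1).
by apply: (is_derive_eq h2); rewrite /GRing.scale/=; ring.
Qed.

Lemma is_derive_std_cdf x : is_derive x 1 std_cdf (std_pdf x).
Proof.
have := @continuous_FTC1 R (normal_pdf 0 1) -oo%O x (x + 1).
case=> //.
- by rewrite ltrDl.
- apply: (@integrableS _ _ _ _ setT) => //.
  exact: integrable_normal_pdf.
- by rewrite ltNyr.
- by apply: continuous_normal_pdf; exact: oner_neq0.
move=> h1 h2; split; first exact: h1.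
by rewrite -derive1E; exact: h2.
Qed.

Lemma is_derive_std_pdf_comp (q : R -> R) x dq : is_derive x 1 q dq ->
  is_derive x 1 (fun t => std_pdf (q t)) (- q x * std_pdf (q x) * dq).
Proof.
move=> hq; have h := is_derive_std_pdf (q x).
exact: (@is_derive1_comp R std_pdf q x _ _ h hq).
Qed.

Lemma is_derive_std_cdf_comp (q : R -> R) x dq : is_derive x 1 q dq ->
  is_derive x 1 (fun t => std_cdf (q t)) (std_pdf (q x) * dq).
Proof.
move=> hq; have h := is_derive_std_cdf (q x).
exact: (@is_derive1_comp R std_cdf q x _ _ h hq).
Qed.

Lemma std_cdf_continuous : continuous std_cdf.
Proof.
move=> x; apply/differentiable_continuous/derivable1_diffP.
by have [] := is_derive_std_cdf x.
Qed.

Lemma std_cdf_itv x : normal_prob (0 : R) 1 `]-oo, x] = (std_cdf x)%:E.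
Proof. by rewrite /std_cdf fineK// fin_num_measure. Qed.

Lemma std_cdf_ge0 x : 0 <= std_cdf x.
Proof. by rewrite -lee_fin -std_cdf_itv. Qed.

Lemma std_cdf_le1 x : std_cdf x <= 1.
Proof. by rewrite -lee_fin -std_cdf_itv probability_le1. Qed.

Lemma std_cdf_nondecreasing : {homo std_cdf : x y / x <= y}.
Proof.
move=> x y xy; rewrite -lee_fin -!std_cdf_itv le_measure ?inE//.
exact: subitvPr.
Qed.

(** A normal variable realised as the identity of the line, so that the general limits of a [cdf] at
    infinity apply to [std_cdf]. *)
Let idR : measurableTypeR R -> R := idfun.

#[local] HB.instance Definition _ :=
  @isMeasurableFun.Build _ _ _ _ idR (@measurable_id _ _ setT).

Let cdf_idR x : cdf (idR : {RV (normal_prob (0 : R) 1) >-> R}) x = (std_cdf x)%:E.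
Proof. by rewrite -std_cdf_itv. Qed.

Lemma cvg_std_cdfy : std_cdf x @[x --> +oo] --> (1 : R).
Proof.
apply: fine_cvg.
rewrite (_ : (fun x => _) = cdf (idR : {RV (normal_prob (0 : R) 1) >-> R})).
  exact: cvg_cdfy1.
by apply/funext => x; rewrite cdf_idR std_cdf_itv.
Qed.

Lemma cvg_std_cdfNy : std_cdf x @[x --> -oo] --> (0 : R).
Proof.
apply: fine_cvg.
rewrite (_ : (fun x => _) = cdf (idR : {RV (normal_prob (0 : R) 1) >-> R})).
  exact: cvg_cdfNy0.
by apply/funext => x; rewrite cdf_idR std_cdf_itv.
Qed.

End standard_normal.

(** * The heat kernel *)

Section heat_kernel.
Context (R : realType).
Implicit Types (s b c r p x z : R).

(* [(t, x) |-> heat t (a - x)] solves the heat equation, with initial value the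
   indicator of [x <= a]. *)
Definition heat s b : R := std_cdf (b / Num.sqrt s).

Let is_derive_rsqrt s x : x < s ->
  is_derive x 1 (fun t => (Num.sqrt (s - t))^-1) ((Num.sqrt (s - x))^-1 ^+ 3 / 2).
Proof.
move=> xs; have sx : 0 < s - x by rewrite subr_gt0.
have h1 : is_derive x 1 (fun t => s - t) (- 1).
  by have := is_derive_affine x (- 1) s; under eq_fun do rewrite mulN1r.
have h2 := @is_derive1_comp R Num.sqrt (fun t => s - t) x _ _ (is_derive1_sqrt sx) h1.
have n0 : (Num.sqrt \o (fun t => s - t)) x != 0.
  by rewrite /= gt_eqF// sqrtr_gt0.
apply: (is_derive_eq (is_deriveV n0 h2)).
rewrite /= /GRing.scale/=; field.
by rewrite gt_eqF// sqrtr_gt0.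
Qed.

Let std_pdf_poly_bound x : 0 <= std_pdf x /\ std_pdf x * (8 + `|x| ^+ 4) <= 8.
Proof.
split; first exact: std_pdf_ge0.
by rewrite (exprM _ 2 2) real_normK ?num_real// -exprM; exact: std_pdf_decay.
Qed.

Lemma std_pdf_poly x (P K : R) : `|P| <= K * (8 + `|x| ^+ 4) ->
  `|P * std_pdf x| <= 8 * K.
Proof.
move=> PK; have [f0 f1] := std_pdf_poly_bound x.
have K0 : 0 <= K.
  have := le_trans (normr_ge0 _) PK; rewrite pmulr_lge0//.
rewrite normrM (ger0_norm f0).
apply: (@le_trans _ _ (K * (8 + `|x| ^+ 4) * std_pdf x)).
  exact: ler_wpM2r.
by rewrite -mulrA mulrC (mulrC _ (std_pdf x)) ler_wpM2r.
Qed.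

(** Effect of one jump of the degree. The terms in [c] and [c ^+ 2] come from the first and second
    space derivatives of [heat], and the third is of order [c ^+ 3]. The second bound is a plain
    Lipschitz estimate, used against the error in the jump probability. *)
Lemma heat_shift s b c z : 1 <= s ->
  c = (Num.sqrt s)^-1 -> z = b * c ->
  `|heat s (b - 1) - heat s b + c * std_pdf z + c ^+ 2 * z * std_pdf z / 2|
    <= 16 * c ^+ 3 /\
  `|heat s (b - 1) - heat s b| <= c.
Proof.
move=> s1 cE ->.
have c0 : 0 <= c by rewrite cE invr_ge0 sqrtr_ge0.
have q x : is_derive x 1 (fun t => b * c + - c * t) (- c).
  exact: is_derive_affine.
have d1 x : is_derive x 1 (fun t => std_cdf (b * c + - c * t))
    (- c * std_pdf (b * c + - c * x)).
  by apply: (is_derive_eq (is_derive_std_cdf_comp (q x))); rewrite mulrC.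
have d2 x : is_derive x 1 (fun t => - c * std_pdf (b * c + - c * t))
    (- c ^+ 2 * (b * c + - c * x) * std_pdf (b * c + - c * x)).
  apply: (is_derive_eq (is_deriveZ (- c)
    (is_derive_std_pdf_comp (q x)))).
  by rewrite /= /GRing.scale/=; ring.
have d3 x : is_derive x 1
    (fun t => - c ^+ 2 * (b * c + - c * t) * std_pdf (b * c + - c * t))
    (c ^+ 3 * ((1 - (b * c + - c * x) ^+ 2) * std_pdf (b * c + - c * x))).
  apply: (is_derive_eq (is_deriveM (is_deriveZ (- c ^+ 2) (q x))
    (is_derive_std_pdf_comp (q x)))).
  by rewrite /= /GRing.scale/=; ring.
split.
  have := @taylor2_bound R _ _ _ _ (16 * c ^+ 3) _ (fun x _ => d1 x)
    (fun x _ => d2 x) (fun x _ => d3 x).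
  have -> : b * c + - c * 1 = (b - 1) * c by ring.
  have -> : b * c + - c * 0 = b * c by ring.
  have -> : std_cdf ((b - 1) * c) - std_cdf (b * c) - - c * std_pdf (b * c) -
      - c ^+ 2 * (b * c) * std_pdf (b * c) / 2 = heat s (b - 1) - heat s b +
      c * std_pdf (b * c) + c ^+ 2 * (b * c) * std_pdf (b * c) / 2.
    by rewrite /heat -cE; ring.
  apply; first by rewrite mulr_ge0// exprn_ge0.
  move=> x _; rewrite normrM ger0_norm ?exprn_ge0// mulrC.
  apply: ler_wpM2r; first by rewrite exprn_ge0.
  (* The factor 8 is that of [std_pdf_poly]; the factor 2 generously bounds |1 - y^2| by 2 (8 +
     y^4). *)
  rewrite (_ : 16 = 8 * 2); last by ring.
  apply: std_pdf_poly; move: (b * c + _) => y.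
  have -> : `|y| ^+ 4 = (y ^+ 2) ^+ 2 by rewrite (exprM _ 2 2) real_normK ?num_real.
  have := sqr_ge0 y; set u := y ^+ 2 => u0.
  have := sqr_ge0 (u - 1) => u1.
  by rewrite ler_norml; apply/andP; split; nra.
have := @is_derive_le_bound R _ _ 0 1 c ler01 (fun x _ => d1 x).
have -> : b * c + - c * 1 = (b - 1) * c by ring.
have -> : b * c + - c * 0 = b * c by ring.
rewrite subr0 mulr1 /heat -cE; apply => x _.
rewrite normrM normrN (ger0_norm c0) ler_piMr//.
have := @std_pdf_poly (b * c + - c * x) 1 8^-1.
rewrite mul1r mulfV//; apply.
rewrite normr1 ler_pdivlMl// mulr1.
have : 0 <= `|b * c + - c * x| ^+ 4 by rewrite exprn_ge0.
lra.
Qed.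

Lemma heat_drift s b r c z : 0 <= r -> 1 <= s - r ->
  c = (Num.sqrt (s - r))^-1 -> z = (b + r) * c ->
  `|heat (s - r) (b + r) - heat s b
    - r * (c * std_pdf z + c ^+ 2 * z * std_pdf z / 2)| <= 32 * c ^+ 2 * r ^+ 2.
Proof.
move=> r0 sr cE zE.
pose C t := (Num.sqrt (s - t))^-1.
pose q t := (b + t) * C t.
pose f t := std_cdf (q t).
pose dq t := C t + q t * C t ^+ 2 / 2.
pose df t := dq t * std_pdf (q t).
pose ddf t := C t ^+ 2 *
  ((- q t * (1 + q t * C t / 2) ^+ 2 + C t + 3 / 4 * q t * C t ^+ 2)
   * std_pdf (q t)).
have lts x : 0 <= x <= r -> x < s by move=> /andP[x0 xr]; lra.
have dC x : x < s -> is_derive x 1 C (C x ^+ 3 / 2) := @is_derive_rsqrt s x.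
have db x : is_derive x 1 (fun t => b + t) 1.
  by have := is_derive_affine x 1 b; under eq_fun do rewrite mul1r.
have dqE x : x < s -> is_derive x 1 q (dq x).
  move=> xs; apply: (is_derive_eq (is_deriveM (db x) (dC x xs))).
  by rewrite /= /GRing.scale/= /dq /q; field.
have ddq x : x < s -> is_derive x 1 dq (C x ^+ 3 + 3 / 4 * q x * C x ^+ 4).
  move=> xs.
  have h := is_deriveD (dC x xs) (is_deriveZ 2^-1
    (is_deriveM (dqE x xs) (is_deriveX 2 (dC x xs)))).
  have -> : dq = C + 2^-1 \*: (q * C ^+ 2).
    by apply/funext => t; rewrite /dq /= mulrC.
  apply: (is_derive_eq h).
  by rewrite /= /GRing.scale/= /dq fctE; field.
have d1 x : 0 <= x <= r -> is_derive x 1 f (df x).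
  move=> /lts xs; apply: (is_derive_eq (is_derive_std_cdf_comp (dqE x xs))).
  by rewrite mulrC.
have d2 x : 0 <= x <= r -> is_derive x 1 df (ddf x).
  move=> /lts xs.
  apply: (is_derive_eq (is_deriveM (ddq x xs) (is_derive_std_pdf_comp (dqE x xs)))).
  by rewrite /= /GRing.scale/= /ddf /dq; field.
have := @taylor1_bound R f df ddf r (32 * c ^+ 2) r0 _ d1 d2.
have -> : f r - f 0 - r * df r = heat (s - r) (b + r) - heat s b
    - r * (c * std_pdf z + c ^+ 2 * z * std_pdf z / 2).
  by rewrite /f /df /dq /q /heat /C -cE -zE addr0 subr0; ring.
apply; first by rewrite mulr_ge0// sqr_ge0.
move=> x /[dup] xr /lts xs; rewrite /ddf normrM ger0_norm ?sqr_ge0// mulrC.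
have C0 : 0 <= C x by rewrite invr_ge0 sqrtr_ge0.
have Cc : C x <= c.
  have rs : r < s by lra.
  rewrite cE lef_pV2 ?posrE ?sqrtr_gt0 ?subr_gt0//.
  by apply: ler_wsqrtr; case/andP: xr => _ ?; lra.
have c1 : c <= 1.
  rewrite cE invf_le1 ?sqrtr_gt0; last by lra.
  by rewrite -[leLHS]sqrtr1 ler_wsqrtr.
have C1 : C x <= 1 by apply: le_trans c1.
have CC : C x ^+ 2 <= c ^+ 2.
  by rewrite ler_sqr ?nnegrE ?(le_trans C0).
apply: ler_pM => //; first exact: sqr_ge0.
rewrite (_ : 32 = 8 * 4); last by ring.
apply: std_pdf_poly.
(* Since [C x <= 1], its remaining powers are dropped, which leaves a cubic in [|y|] to compare with
   4 (8 + |y|^4). *)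
move: (q x) (C x) C0 C1 => y k k0 k1.
apply: (@le_trans _ _ (`|y| * (1 + `|y| / 2) ^+ 2 + 1 + 3 / 4 * `|y|)).
  apply: (le_trans (ler_normD _ _)); apply: lerD.
    apply: (le_trans (ler_normD _ _)); apply: lerD; last by rewrite ger0_norm.
    rewrite normrM normrN; apply: ler_wpM2l => //; rewrite normrX.
    rewrite lerXn2r ?nnegrE// ?addr_ge0// ?divr_ge0//.
    apply: (le_trans (ler_normD _ _)); rewrite normr1 lerD2l.
    by rewrite !normrM (ger0_norm k0) (@ger0_norm _ 2^-1)// ler_wpM2r// ler_piMr.
  rewrite normrM (@ger0_norm _ (k ^+ 2)) ?sqr_ge0// normrM (@ger0_norm _ (3 / 4))//.
  by rewrite ler_piMr ?mulr_ge0// exprn_ile1.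
have : 0 <= `|y| by [].
move: `|y| => a a0.
have a2 := sqr_ge0 (a ^+ 2 - 1); have a1 := sqr_ge0 (a - 1).
have a3 := sqr_ge0 (a ^+ 2 - a).
have -> : a ^+ 4 = (a ^+ 2) ^+ 2 by rewrite -exprM.
nra.
Qed.

(** If [p = r], the main terms of [heat_drift] and [heat_shift] cancel; the discrepancy [p - r] only
    multiplies the Lipschitz bound. *)
Lemma heat_step s b r p c : 0 <= r -> 1 <= s - r ->
  c = (Num.sqrt (s - r))^-1 ->
  `|heat (s - r) (b + r) - heat s b
    + p * (heat (s - r) (b + r - 1) - heat (s - r) (b + r))|
  <= 32 * c ^+ 2 * r ^+ 2 + 16 * c ^+ 3 * r + `|p - r| * c.
Proof.
move=> r0 sr cE.
have := heat_drift r0 sr cE (erefl ((b + r) * c)).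
have [] := heat_shift sr cE (erefl ((b + r) * c)).
set D := _ * std_pdf _; set E := _ * std_pdf _ / 2.
set u := heat (s - r) (b + r - 1) - heat _ _.
set v := _ - heat s b => h1 h2 h3.
have -> : v + p * u = (v - r * (D + E)) + r * (u + D + E) + (p - r) * u by ring.
apply: (le_trans (ler_normD _ _)); apply: lerD; last first.
  by rewrite normrM ler_wpM2l.
apply: (le_trans (ler_normD _ _)); apply: lerD => //.
by rewrite normrM (ger0_norm r0) mulrC ler_wpM2r.
Qed.

End heat_kernel.

(** * The chain of degree distributions *)

Section ln_increment.
Context (R : realType).
Implicit Types n : nat.

(** Both follow from ln (1 + x) <= x, at x = - 1 / (n + 1) and at x = 1 / n. *)
Lemma ln_increment_bounds n : (2 <= n)%N ->
  n.+1%:R^-1 <= ln n.+1%:R - ln n%:R :> R /\ ln n.+1%:R - ln n%:R <= n%:R^-1 :> R.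
Proof.
move=> n2; have n0 : 0 < n%:R :> R by rewrite ltr0n; lia.
have m0 : 0 < n.+1%:R :> R by rewrite ltr0n.
split.
  have h : n%:R / n.+1%:R = 1 + - n.+1%:R^-1 :> R.
    by rewrite -natr1; field; rewrite natr1 gt_eqF.
  have h1 : -1 < - n.+1%:R^-1 :> R by rewrite ltrN2 invf_lt1// ltr1n; lia.
  by have := le_ln1Dx h1; rewrite -h ln_div ?posrE// lerNr opprB.
have h : n.+1%:R / n%:R = 1 + n%:R^-1 :> R.
  by rewrite -natr1; field; rewrite gt_eqF.
have h1 : -1 < n%:R^-1 :> R by rewrite (@lt_trans _ _ 0) ?invr_gt0// ltrN10.
by have := le_ln1Dx h1; rewrite -h ln_div ?posrE.
Qed.

End ln_increment.

(* [f n d] is the probability that the fixed vertex has degree [d] at time [n]. *)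
Section degree_chain.
Context (R : realType).
Variables (f : nat -> nat -> R) (n0 : nat).

Definition attach_prob n d : R := 1 / (n%:R - 1) * (1 - d%:R / (2 * n%:R - 1)).

Local Notation p := attach_prob.

(** The crude support bound 2n keeps all sums finite; [dlaw_mass] allows any longer range, so that
    one range can serve all times up to a horizon. *)
Record degree_law : Prop := DegreeLaw {
  dlaw_start : (2 <= n0)%N;
  dlaw_ge0 : forall n d, 0 <= f n d;
  dlaw_supp : forall n d, (n0 <= n)%N -> (n.*2 < d)%N -> f n d = 0;
  dlaw_mass : forall n m, (n0 <= n)%N -> (n.*2 <= m)%N -> \sum_(d < m.+1) f n d = 1;
  dlaw_rec0 : forall n, (n0 <= n)%N -> f n.+1 0 = f n 0 * (1 - p n 0);
  dlaw_recS : forall n d, (n0 <= n)%N ->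
    f n.+1 d.+1 = f n d * p n d + f n d.+1 * (1 - p n d.+1)
}.

Hypothesis hf : degree_law.

(** The recursion in dual form, obtained by shifting the index: conditioning on the degree at time
    [n], the test function gains [V d.+1 - V d] with probability [p n d]. *)
Lemma dlaw_expectation_step n m (V : nat -> R) : (n0 <= n)%N -> (n.*2 < m)%N ->
  \sum_(d < m.+1) V d * f n.+1 d =
  \sum_(d < m.+1) (V d + p n d * (V d.+1 - V d)) * f n d.
Proof.
move=> n0n nm; rewrite big_ord_recl /= dlaw_rec0//.
under eq_bigr => d _ do rewrite /bump add1n (dlaw_recS hf)// mulrDr.
rewrite big_split/= [X in _ + (X + _)](_ : _ =
    \sum_(d < m.+1) V d.+1 * (f n d * p n d)); last first.
  (* The shifted sum lacks the term [d = m], which vanishes because [m] lies beyond the support. *)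
  by rewrite big_ord_recr/= (dlaw_supp hf)// mul0r mulr0 addr0.
rewrite addrCA [X in _ + X](_ : _ =
    \sum_(d < m.+1) V d * (f n d * (1 - p n d))); last first.
  by rewrite [RHS]big_ord_recl.
by rewrite -big_split/=; apply: eq_bigr => d _; ring.
Qed.

Section up_to_time.
Variable N : nat.

Let m := N.*2.+1.
Let Q n := \sum_(d < m.+1) d%:R * f n d.
(** The errors at time [n] carry [Q n + 34], where 34 is 32 from [heat_step] plus 2 from
    [attach_prob_increment]. One more unit pays for the growth of the mean [Q] in a step. *)
Let potential n := (Q n + 35) / (n%:R - 1).

Let Q_ge0 n : 0 <= Q n.
Proof. by apply: sumr_ge0 => d _; rewrite mulr_ge0//; exact: dlaw_ge0. Qed.

Let Q_start : (n0 <= N)%N -> Q n0 <= n0.*2%:R.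
Proof.
move=> n0N; apply: (@le_trans _ _ (\sum_(d < m.+1) n0.*2%:R * f n0 d)); last first.
  by rewrite -mulr_sumr (dlaw_mass hf) ?mulr1// /m; lia.
apply: ler_sum => d _; have [dn|dn] := leqP d n0.*2.
  by rewrite ler_wpM2r ?ler_nat//; exact: dlaw_ge0.
by rewrite (dlaw_supp hf)// !mulr0.
Qed.

Let Q_step n : (n0 <= n < N)%N -> Q n.+1 <= Q n + 1 / (n%:R - 1).
Proof.
move=> /andP[n0n nN]; have n2 := leq_trans (dlaw_start hf) n0n.
rewrite /Q dlaw_expectation_step//; last by rewrite /m; lia.
have mass : \sum_(d < m.+1) f n d = 1 by apply: dlaw_mass => //; rewrite /m; lia.
rewrite -[X in _ <= _ + X]mulr1 -[X in _ <= _ + _ * X]mass.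
rewrite mulr_sumr -big_split/=; apply: ler_sum => d _.
rewrite mulrDl lerD2l -natr1 addrAC subrr add0r mulr1.
apply: ler_wpM2r; first exact: (dlaw_ge0 hf).
have n1 : 2 <= n%:R :> R by rewrite ler_nat.
rewrite /attach_prob ler_piMr ?divr_ge0//; first by lra.
by rewrite gerBl divr_ge0//; lra.
Qed.

Let potential_step n : (n0 <= n < N)%N ->
  (Q n + 34) / ((n%:R - 1) * n%:R) <= potential n - potential n.+1.
Proof.
move=> nN; have n2 : (2 <= n)%N.
  by apply: leq_trans (dlaw_start hf) _; case/andP: nN.
have n1 : 2 <= n%:R :> R by rewrite ler_nat.
have h := Q_step nN.
have -> : potential n - potential n.+1 = (Q n + 34) / ((n%:R - 1) * n%:R)
    + (Q n + 1 / (n%:R - 1) - Q n.+1) / n%:R.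
  rewrite /potential -natr1; field.
  by rewrite !gt_eqF//; lra.
by rewrite lerDl divr_ge0//; lra.
Qed.

(** The logarithmic increment lies between 1 / (n + 1) and 1 / n, hence within 2 / ((n - 1) n) of 1
    / (n - 1); the degree term is bounded separately. *)
Lemma attach_prob_increment n d : (2 <= n)%N ->
  `|p n d - (ln n.+1%:R - ln n%:R)| <= (2 + d%:R) / ((n%:R - 1) * n%:R).
Proof.
move=> n2; have n1 : 2 <= n%:R :> R by rewrite ler_nat.
have [] := ln_increment_bounds R n2; move: (_ - _) => r r1 r2.
have -> : p n d - r = (1 / (n%:R - 1) - r) - d%:R / ((n%:R - 1) * (2 * n%:R - 1)).
  by rewrite /attach_prob; field; rewrite !gt_eqF//; lra.
apply: (le_trans (ler_normB _ _)); rewrite [leRHS]mulrDl; apply: lerD.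
  have h : 0 <= 1 / (n%:R - 1) - n%:R^-1 :> R.
    have -> : 1 / (n%:R - 1) - n%:R^-1 = 1 / ((n%:R - 1) * n%:R) :> R.
      by field; rewrite !gt_eqF//; lra.
    by rewrite divr_ge0// mulr_ge0//; lra.
  rewrite ger0_norm; last by lra.
  apply: (@le_trans _ _ (1 / (n%:R - 1) - n.+1%:R^-1)); first by rewrite lerD2l lerN2.
  have -> : 1 / (n%:R - 1) - n.+1%:R^-1 = 2 / ((n%:R - 1) * (n%:R + 1)) :> R.
    by rewrite -natr1; field; rewrite !gt_eqF//; lra.
  rewrite ler_pM2l// lef_pV2 ?posrE ?mulr_gt0//; lra.
rewrite ger0_norm; last by rewrite divr_ge0// mulr_ge0//; lra.
apply: ler_wpM2l => //; rewrite lef_pV2 ?posrE ?mulr_gt0//; try lra.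
by rewrite ler_wpM2l; lra.
Qed.

(* Summing [heat_step] along the chain; [1 / (n (n - 1))]-type errors are
   absorbed by the decrease of [potential]. *)
Lemma dlaw_heat_bound (S A c : R) : (n0 <= N)%N -> 0 < c -> c <= 1 ->
  S - ln N%:R = c ^- 2 ->
  `|\sum_(d < m.+1) heat (S - ln N%:R) (A + ln N%:R - d%:R) * f N d -
    \sum_(d < m.+1) heat (S - ln n0%:R) (A + ln n0%:R - d%:R) * f n0 d|
  <= c * (n0.*2%:R + 35) + 16 * c ^+ 3 * ln N%:R.
Proof.
move=> n0N c0 c1 SN.
pose v n := \sum_(d < m.+1) heat (S - ln n%:R) (A + ln n%:R - d%:R) * f n d.
(* A telescoping majorant: its increments dominate those of [v]. *)
pose g n : R := - c * potential n + 16 * c ^+ 3 * ln n%:R.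
have step n : (n0 <= n < N)%N -> `|v n.+1 - v n| <= g n.+1 - g n.
  move=> /[dup] nN /andP[n0n ltnN].
  have n2 := leq_trans (dlaw_start hf) n0n.
  have n1 : 2 <= n%:R :> R by rewrite ler_nat.
  set r : R := ln n.+1%:R - ln n%:R.
  have [r1 r2] := ln_increment_bounds R n2; rewrite -/r in r1 r2.
  have r0 : 0 <= r by apply: le_trans r1.
  have lnN : ln n.+1%:R <= ln N%:R :> R.
    by rewrite ler_ln ?posrE ?ltr0n ?ler_nat//; lia.
  have c2 : 1 <= c ^- 2 by rewrite invf_ge1 ?exprn_gt0// exprn_ile1// ltW.
  pose k := (Num.sqrt (S - ln n%:R - r))^-1.
  have Sr : S - ln n%:R - r = S - ln n.+1%:R by rewrite /r; ring.
  have Ss : c ^- 2 <= S - ln n%:R - r by rewrite Sr; lra.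
  have k0 : 0 <= k by rewrite invr_ge0 sqrtr_ge0.
  (* Before the horizon the remaining heat time is at least its final value [c ^- 2]. *)
  have kc : k <= c.
    rewrite -[leRHS]invrK lef_pV2 ?posrE ?invr_gt0 ?sqrtr_gt0//; last by lra.
    rewrite -[leLHS](@gtr0_norm _ c^-1) ?invr_gt0// -sqrtr_sqr exprVn.
    exact: ler_wsqrtr.
  rewrite /v (@dlaw_expectation_step n m
    (fun d => heat (S - ln n.+1%:R) (A + ln n.+1%:R - d%:R)))//; last by rewrite /m; lia.
  rewrite -sumrB.
  apply: (@le_trans _ _ (\sum_(d < m.+1) (c * ((34 + d%:R) / ((n%:R - 1) * n%:R))
      + 16 * c ^+ 3 * r) * f n d)).
    apply: (le_trans (ler_norm_sum _ _ _)); apply: ler_sum => d _.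
    rewrite -mulrBl normrM (ger0_norm (dlaw_ge0 hf _ _)).
    apply: ler_wpM2r; first exact: (dlaw_ge0 hf).
    have Sr1 : 1 <= S - ln n%:R - r by lra.
    have := @heat_step R (S - ln n%:R) (A + ln n%:R - d%:R) r (p n d) k r0 Sr1 erefl.
    have -> : A + ln n%:R - d%:R + r = A + ln n.+1%:R - d%:R by rewrite /r; ring.
    have -> : A + ln n.+1%:R - d%:R - 1 = A + ln n.+1%:R - d.+1%:R.
      by rewrite -(natr1 d); ring.
    rewrite Sr addrAC => /le_trans; apply.
    have pr := attach_prob_increment d n2; rewrite -/r in pr.
    have rq : r ^+ 2 <= ((n%:R - 1) * n%:R)^-1.
      apply: (@le_trans _ _ (n%:R^-1 ^+ 2)).
        by apply: lerXn2r; rewrite ?nnegrE// invr_ge0.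
      rewrite exprVn lef_pV2 ?posrE ?mulr_gt0 ?exprn_gt0//; lra.
    move: ((n%:R - 1) * n%:R)^-1 rq pr => q rq pr.
    (* Giving up one factor [k <= 1] puts the [r ^+ 2] error in the same form [c * q] as the error
       in the jump probability. *)
    have k2 : k ^+ 2 <= c.
      rewrite expr2; apply: (@le_trans _ _ (c * 1)); last by rewrite mulr1.
      by apply: ler_pM => //; apply: le_trans c1.
    have k3 : k ^+ 3 <= c ^+ 3 by apply: lerXn2r; rewrite ?nnegrE// ltW.
    have e1 : k ^+ 2 * r ^+ 2 <= c * q by apply: ler_pM; rewrite ?sqr_ge0.
    have e2 : k ^+ 3 * r <= c ^+ 3 * r by apply: ler_wpM2r.
    have e3 : `|p n d - r| * k <= (2 + d%:R) * q * c by apply: ler_pM.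
    have -> : c * ((34 + d%:R) * q) + 16 * c ^+ 3 * r =
      32 * (c * q) + 16 * (c ^+ 3 * r) + (2 + d%:R) * q * c by ring.
    by rewrite -2!(mulrA _ (k ^+ _)); lra.
  have := potential_step nN; rewrite /g.
  have mass : \sum_(d < m.+1) f n d = 1 by apply: dlaw_mass => //; rewrite /m; lia.
  have -> : \sum_(d < m.+1) (c * ((34 + d%:R) / ((n%:R - 1) * n%:R))
      + 16 * c ^+ 3 * r) * f n d =
      c * ((Q n + 34) / ((n%:R - 1) * n%:R)) + 16 * c ^+ 3 * r.
    have -> : c * ((Q n + 34) / ((n%:R - 1) * n%:R)) + 16 * c ^+ 3 * r =
        c / ((n%:R - 1) * n%:R) * Q n +
        (c * 34 / ((n%:R - 1) * n%:R) + 16 * c ^+ 3 * r) * 1 by ring.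
    rewrite -[X in _ = _ + _ * X]mass /Q !mulr_sumr -big_split/=.
    by apply: eq_bigr => d _; ring.
  move=> h.
  have -> : - c * potential n.+1 + 16 * c ^+ 3 * ln n.+1%:R -
      (- c * potential n + 16 * c ^+ 3 * ln n%:R) =
      c * (potential n - potential n.+1) + 16 * c ^+ 3 * r by rewrite /r; ring.
  by rewrite lerD2r ler_pM2l.
have tele n : (n0 <= n <= N)%N -> `|v n - v n0| <= g n - g n0.
  elim: n => [|n ih] /andP[n0n nN].
    by have := dlaw_start hf; lia.
  move: n0n; rewrite leq_eqVlt => /predU1P[->|]; first by rewrite !subrr normr0.
  rewrite ltnS => n0n.
  have -> : v n.+1 - v n0 = (v n.+1 - v n) + (v n - v n0) by ring.
  have -> : g n.+1 - g n0 = (g n.+1 - g n) + (g n - g n0) by ring.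
  apply: (le_trans (ler_normD _ _)); apply: lerD.
    by apply: step; rewrite n0n.
  by apply: ih; rewrite n0n ltnW.
have := tele N; rewrite n0N leqnn => /(_ isT) /le_trans; apply.
have n1 : 2 <= n0%:R :> R by rewrite ler_nat; exact: dlaw_start.
have N1 : 2 <= N%:R :> R by rewrite (le_trans n1)// ler_nat.
have pN : 0 <= potential N by have q0 := Q_ge0 N; rewrite /potential divr_ge0//; lra.
have pn0 : potential n0 <= n0.*2%:R + 35.
  rewrite /potential ler_pdivrMr; last by lra.
  have := Q_start n0N; have := Q_ge0 n0; nra.
have l0 : 0 <= ln n0%:R :> R by rewrite ln_ge0//; lra.
have c3 : 0 <= 16 * c ^+ 3 by rewrite mulr_ge0// exprn_ge0// ltW.
rewrite /g; nra.
Qed.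

End up_to_time.

End degree_chain.

(** * Central limit theorem for the chain *)

Section central_limit.
Context (R : realType).

Lemma cvg_sqrt_ln : Num.sqrt (ln n%:R) @[n --> \oo] --> (+oo : set_system R).
Proof.
apply/cvgryPge => A.
have /cvgryPge/(_ (expR (A ^+ 2))) h := @cvgr_idn R.
near=> n.
have hn : expR (A ^+ 2) <= n%:R by near: n; exact: h.
have n0 : 0 < n%:R :> R by apply: lt_le_trans hn; exact: expR_gt0.
apply: (le_trans (ler_norm A)); rewrite -sqrtr_sqr ler_wsqrtr//.
by rewrite -[leLHS]expRK ler_ln ?posrE// expR_gt0.
Unshelve. all: by end_near. Qed.

Lemma cvg_sqrt_lnV : (Num.sqrt (ln n%:R))^-1 @[n --> \oo] --> (0 : R).
Proof.
apply/gtr0_cvgV0; last exact: cvg_sqrt_ln.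
by move/cvgryPgt : cvg_sqrt_ln; apply.
Qed.

Variables (f : nat -> nat -> R) (n0 : nat).
Hypothesis hf : degree_law f n0.

Definition standardize (N d : nat) : R := (d%:R - ln N%:R) / Num.sqrt (ln N%:R).

(** The distribution function at [x] of W + s Z, with W the standardized degree and Z an independent
    standard normal variable. *)
Let smoothed_cdf (s x : R) N :=
  \sum_(d < N.*2.+2) std_cdf ((x - standardize N d) / s) * f N d.

(** The heat average at the fixed time [n0], with the clock and the level set for the horizon
    [N]. *)
Let start (s x : R) N :=
  \sum_(d < n0.*2.+1) heat ((1 + s ^+ 2) * ln N%:R - ln n0%:R)
    (x * Num.sqrt (ln N%:R) + ln n0%:R - d%:R) * f n0 d.

(** After division by the square root of [ln N], everything depending on [n0] and [d] vanishes in
    the limit; the sum is finite and has mass 1. *)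
Let cvg_start s x : 0 < s ->
  start s x @ \oo --> std_cdf (x / Num.sqrt (1 + s ^+ 2)).
Proof.
move=> s0; have s2 : 0 < 1 + s ^+ 2 by rewrite ltr_pwDl// sqr_ge0.
have -> : std_cdf (x / Num.sqrt (1 + s ^+ 2)) =
    \sum_(d < n0.*2.+1) std_cdf (x / Num.sqrt (1 + s ^+ 2)) * f n0 d.
  by rewrite -mulr_sumr (dlaw_mass hf)// mulr1.
apply: (cvg_big add_continuous) => d _; apply: cvgM; last exact: cvg_cst.
pose y n : R := (Num.sqrt (ln n%:R))^-1.
apply: (@cvg_trans _ (std_cdf ((x + (ln n0%:R - d%:R) * y n) /
    Num.sqrt (1 + s ^+ 2 - ln n0%:R * (y n * y n))) @[n --> \oo])).
  apply: near_eq_cvg; near=> n.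
  have L0 : 0 < Num.sqrt (ln n%:R) :> R.
    by near: n; move/cvgryPgt : cvg_sqrt_ln; apply.
  have L1 : 0 < ln n%:R :> R by rewrite -sqrtr_gt0.
  rewrite /heat /y.
  have -> : (1 + s ^+ 2) * ln n%:R - ln n0%:R =
      ln n%:R * (1 + s ^+ 2 - ln n0%:R *
        ((Num.sqrt (ln n%:R))^-1 * (Num.sqrt (ln n%:R))^-1)).
    have sE : Num.sqrt (ln n%:R) * Num.sqrt (ln n%:R) = ln n%:R :> R.
      by rewrite -expr2 sqr_sqrtr// ltW.
    by rewrite -invfM sE; field; rewrite gt_eqF.
  rewrite (sqrtrM _ (ltW L1)); congr std_cdf.
  rewrite invfM; set u := (Num.sqrt (1 + _ - _))^-1.
  by field; rewrite gt_eqF.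
have y0 : y n @[n --> \oo] --> (0 : R) := cvg_sqrt_lnV.
have num : x + (ln n0%:R - d%:R) * y n @[n --> \oo] --> x + (ln n0%:R - d%:R) * 0.
  by apply: cvgD; [exact: cvg_cst|apply: cvgM => //; exact: cvg_cst].
have den : 1 + s ^+ 2 - ln n0%:R * (y n * y n) @[n --> \oo] -->
    1 + s ^+ 2 - ln n0%:R * (0 * 0).
  apply: cvgB; first exact: cvg_cst.
  by apply: cvgM; [exact: cvg_cst|apply: cvgM].
rewrite mulr0 addr0 in num; rewrite !mulr0 subr0 in den.
apply: (continuous_cvg _ (@std_cdf_continuous R _)).
apply: cvgM => //; apply: cvgV; first by rewrite gt_eqF// sqrtr_gt0.
exact: (continuous_cvg _ (@sqrt_continuous R _) den).
Unshelve. all: by end_near. Qed.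

(** [smoothed_cdf] and [start] are the two ends in [dlaw_heat_bound] for [c] the inverse of s sqrt
    (ln N). The bound there then equals [K] / sqrt (ln N). *)
Let cvg_smoothed s x : 0 < s ->
  smoothed_cdf s x @ \oo --> std_cdf (x / Num.sqrt (1 + s ^+ 2)).
Proof.
move=> s0.
pose K : R := s^-1 * (n0.*2%:R + 35) + 16 * s^-1 ^+ 3.
pose y n : R := (Num.sqrt (ln n%:R))^-1.
have y0 : y n @[n --> \oo] --> (0 : R) := cvg_sqrt_lnV.
have Ky0 : K * y n @[n --> \oo] --> (0 : R).
  by rewrite -(mulr0 K); apply: cvgM => //; exact: cvg_cst.
have diff : (smoothed_cdf s x - start s x) @ \oo --> (0 : R).
  apply/norm_cvg0P; apply: (squeeze_cvgr _ (cvg_cst 0) Ky0).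
  near=> n; rewrite normr_ge0/=.
  have n0n : (n0 <= n)%N by near: n; exact: nbhs_infty_ge.
  have Ls : s^-1 <= Num.sqrt (ln n%:R) :> R.
    by near: n; move/cvgryPge : cvg_sqrt_ln; apply.
  have L0 : 0 < Num.sqrt (ln n%:R) :> R by apply: lt_le_trans Ls; rewrite invr_gt0.
  have L1 : 0 < ln n%:R :> R by rewrite -sqrtr_gt0.
  have sE : Num.sqrt (ln n%:R) ^+ 2 = ln n%:R :> R by rewrite sqr_sqrtr// ltW.
  pose c := s^-1 * y n.
  have c0 : 0 < c by rewrite mulr_gt0 ?invr_gt0.
  have c1 : c <= 1 by rewrite /c /y ler_pdivrMr// mul1r.
  have SN : (1 + s ^+ 2) * ln n%:R - ln n%:R = c ^- 2.
    by rewrite /c /y -exprVn invfM !invrK exprMn sE; ring.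
  have := dlaw_heat_bound hf (x * Num.sqrt (ln n%:R)) n0n c0 c1 SN.
  have -> : c * (n0.*2%:R + 35) + 16 * c ^+ 3 * ln n%:R = K * y n.
    rewrite /K /c /y -[X in _ + _ * X = _]sE; field.
    by rewrite !gt_eqF.
  apply: le_trans; rewrite le_eqVlt; apply/orP; left; apply/eqP.
  congr (`|_ - _|).
    apply: eq_bigr => d _; congr (std_cdf _ * _).
    rewrite SN -exprVn sqrtr_sqr gtr0_norm ?invr_gt0// /c /y invfM !invrK /standardize.
    field.
    by rewrite !gt_eqF.
  (* The bound sums over the range of the horizon; at time [n0] the terms above [n0.*2] vanish. *)
  have -> : n.*2.+2 = (n0.*2.+1 + (n.*2.+1 - n0.*2))%N by lia.
  rewrite big_split_ord/= [X in _ = _ + X]big1 ?addr0//.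
  by move=> d _; rewrite (dlaw_supp hf) ?mulr0//=; lia.
have -> : smoothed_cdf s x = (smoothed_cdf s x - start s x) + start s x.
  by rewrite subrK.
by rewrite -[X in _ --> X]add0r; apply: cvgD => //; exact: cvg_start.
Unshelve. all: by end_near. Qed.

(** Smoothing at scale t^2 is combined with a shift of [x] by t or -t. The shift tends to 0, yet it
    is 1 / t smoothing scales wide, so the smoothed step is nearly 1 or 0 on the wanted side of
    [x]. *)
Lemma dlaw_clt (x : R) :
  \sum_(d < N.*2.+2 | standardize N d <= x) f N d @[N --> \oo] --> std_cdf x.
Proof.
have s_cvg : Num.sqrt (1 + (t ^+ 2) ^+ 2) @[t --> (0 : R)] -->
    Num.sqrt (1 + (0 ^+ 2) ^+ 2).
  apply: (continuous_cvg _ (@sqrt_continuous R _)).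
  apply: cvgD; [exact: cvg_cst|].
  by do 2 apply: (continuous_cvg _ (@sqr_continuous R _)); exact: cvg_id.
have shift_cvg (e : R) :
    std_cdf ((x + e * t) / Num.sqrt (1 + (t ^+ 2) ^+ 2)) @[t --> (0 : R)]
    --> std_cdf x.
  have -> : std_cdf x = std_cdf ((x + e * 0) / Num.sqrt (1 + (0 ^+ 2) ^+ 2)).
    by rewrite mulr0 addr0 expr0n/= expr0n/= addr0 sqrtr1 divr1.
  apply: (continuous_cvg _ (@std_cdf_continuous R _)).
  apply: cvgM.
    by apply: cvgD; [exact: cvg_cst|apply: cvgM; [exact: cvg_cst|exact: cvg_id]].
  apply: cvgV; last exact: s_cvg.
  by rewrite expr0n/= expr0n/= addr0 sqrtr1.
apply/cvgrPdist_le => e e0.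
have e3 : 0 < e / 3 by rewrite divr_gt0.
have [M1 [_ M1P]] : \forall t \near +oo, `|1 - std_cdf t| <= e / 3.
  by move/cvgrPdist_le : (@cvg_std_cdfy R); apply.
have [M2 [_ M2P]] : \forall t \near -oo, `|0 - std_cdf t| <= e / 3.
  by move/cvgrPdist_le : (@cvg_std_cdfNy R); apply.
(* Beyond [M] both normal tails are at most e / 3; the added units make the comparisons strict. *)
pose M := Num.max 1 (Num.max (M1 + 1) (1 - M2)).
have M0 : 0 < M by rewrite lt_max ltr01.
have M1M : M1 < M by rewrite !lt_max ltrDl ltr01 orbT.
have M2M : - M < M2.
  by rewrite ltrNl !lt_max -[X in [|| _, _ | X]]subr_gt0 opprK addrNK ltr01 !orbT.
have [t [t0 tM tp tn]] : exists t : R, [/\ 0 < t, t <= M^-1,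
    `|std_cdf x - std_cdf ((x + 1 * t) / Num.sqrt (1 + (t ^+ 2) ^+ 2))| <= e / 6 &
    `|std_cdf x - std_cdf ((x + -1 * t) / Num.sqrt (1 + (t ^+ 2) ^+ 2))| <= e / 6].
  have e6 : 0 < e / 6 by rewrite divr_gt0.
  apply: (@filter_ex _ (0 : R)^'+).
  near=> t; split.
  - by near: t; exact: nbhs_right_gt.
  - by near: t; apply: nbhs_right_le; rewrite invr_gt0.
  - by near: t; move/cvg_at_right_filter/cvgrPdist_le : (shift_cvg 1); apply.
  - by near: t; move/cvg_at_right_filter/cvgrPdist_le : (shift_cvg (-1)); apply.
have Mt : M <= t^-1 by rewrite -[M]invrK lef_pV2 ?posrE ?invr_gt0.
have tail1 : 1 - e / 3 <= std_cdf t^-1.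
  by have := M1P _ (lt_le_trans M1M Mt); rewrite ler_norml => /andP[]; lra.
have tail2 : std_cdf (- t^-1) <= e / 3.
  have := M2P (- t^-1); rewrite sub0r normrN ger0_norm ?std_cdf_ge0//; apply.
  by apply: le_lt_trans M2M; rewrite lerN2.
have t2 : 0 < t ^+ 2 by rewrite exprn_gt0.
have cvg1 : \forall n \near \oo, `|std_cdf ((x + 1 * t) / Num.sqrt (1 + (t ^+ 2) ^+ 2)) -
    smoothed_cdf (t ^+ 2) (x + 1 * t) n| <= e / 6.
  by move/cvgrPdist_le : (@cvg_smoothed (t ^+ 2) (x + 1 * t) t2); apply;
    rewrite divr_gt0.
have cvg2 : \forall n \near \oo, `|std_cdf ((x + -1 * t) / Num.sqrt (1 + (t ^+ 2) ^+ 2)) -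
    smoothed_cdf (t ^+ 2) (x + -1 * t) n| <= e / 6.
  by move/cvgrPdist_le : (@cvg_smoothed (t ^+ 2) (x + -1 * t) t2); apply;
    rewrite divr_gt0.
near=> n.
have n0n : (n0 <= n)%N by near: n; exact: nbhs_infty_ge.
have nP1 : `|std_cdf ((x + 1 * t) / Num.sqrt (1 + (t ^+ 2) ^+ 2)) -
    smoothed_cdf (t ^+ 2) (x + 1 * t) n| <= e / 6 by near: n.
have nP2 : `|std_cdf ((x + -1 * t) / Num.sqrt (1 + (t ^+ 2) ^+ 2)) -
    smoothed_cdf (t ^+ 2) (x + -1 * t) n| <= e / 6 by near: n.
have mass : \sum_(d < n.*2.+2) f n d = 1 by apply: (dlaw_mass hf).
set w := standardize n.
(* Termwise comparison, the slack e / 3 being spread over the unit mass. The total error is e / 3 +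
   e / 6 + e / 6, below [e]. *)
have upper : \sum_(d < n.*2.+2 | w d <= x) f n d <=
    smoothed_cdf (t ^+ 2) (x + 1 * t) n + e / 3.
  rewrite -[X in _ <= _ + X]mulr1 -[X in _ <= _ + _ * X]mass mulr_sumr.
  rewrite -big_split/= big_mkcond/=; apply: ler_sum => d _.
  rewrite -mulrDl -/w; have fd := dlaw_ge0 hf n d.
  have P0 := std_cdf_ge0 ((x + 1 * t - w d) / t ^+ 2).
  case: ifPn => [wx|_]; last by rewrite mulr_ge0//; lra.
  rewrite ler_peMl//.
  have := @std_cdf_nondecreasing R t^-1 ((x + 1 * t - w d) / t ^+ 2).
  have -> : t^-1 <= (x + 1 * t - w d) / t ^+ 2.
    have -> : t^-1 = t / t ^+ 2 by field; rewrite gt_eqF.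
    by rewrite ler_pM2r ?invr_gt0//; lra.
  by move=> /(_ isT); lra.
have lower : smoothed_cdf (t ^+ 2) (x + -1 * t) n <=
    \sum_(d < n.*2.+2 | w d <= x) f n d + e / 3.
  rewrite -[X in _ <= _ + X]mulr1 -[X in _ <= _ + _ * X]mass mulr_sumr.
  rewrite [in leRHS]big_mkcond/= -big_split/=; apply: ler_sum => d _.
  rewrite -/w; have fd := dlaw_ge0 hf n d.
  case: ifPn => [wx|].
    apply: (@le_trans _ _ (f n d)); first by rewrite ler_piMl// std_cdf_le1.
    by rewrite lerDl mulr_ge0//; lra.
  rewrite -ltNge => xw; rewrite add0r ler_wpM2r//; apply: le_trans tail2.
  apply: std_cdf_nondecreasing.
  have -> : - t^-1 = - t / t ^+ 2 by field; rewrite gt_eqF.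
  by rewrite ler_pM2r ?invr_gt0//; lra.
move: nP1 nP2 tp tn; rewrite !ler_norml.
move=> /andP[? ?] /andP[? ?] /andP[? ?] /andP[? ?].
by apply/andP; split; lra.
Unshelve. all: by end_near. Qed.

End central_limit.

(** * The degree process *)

Section graphs.
Implicit Types (g : hgraph) (i j : nat).

Lemma degree_attach i j g :
  degree i (attach j g) = (degree i g + (((nverts g).+1 == i) + (j == i)))%N.
Proof. by rewrite /degree /attach/= -cats1 big_cat big_seq1/= addnAC. Qed.

(** The last edge records the chosen vertex, so attachments to different vertices exclude each
    other. *)
Lemma attach_inj g : injective (fun i => attach i g).
Proof. by move=> i j /(congr1 edges) e; have [] := @rcons_injr _ _ _ _ e. Qed.

Lemma degree_initial_graph_le i h : (degree i (initial_graph h) <= 4)%N.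
Proof.
rewrite /degree /initial_graph big_seq1/=.
by case: eqP; case: eqP; case: eqP.
Qed.

Lemma countable_hgraph : countable [set: hgraph].
Proof.
pose code g := (nverts g, edges g, half_edges g).
apply/countable_injP; exists (pickle \o code) => g h _ _ /= /(pcan_inj pickleK).
by case: g h => [a b c] [a' b' c'] [-> -> ->].
Qed.

End graphs.

Section almost_everywhere.
Context d (T : measurableType d) (R : realType) (mu : measure T R).

Lemma measure_ae_le (A B : set T) : measurable A -> measurable B ->
  {ae mu, forall w, A w -> B w} -> (mu A <= mu B)%E.
Proof.
move=> mA mB [N [mN N0 ABN]].
rewrite -(measureU0 mB mN N0); apply: le_measure; rewrite ?inE//.
  exact: measurableU.
move=> w Aw; have [Bw|Bw] := pselect (B w); [by left|right].
by apply: ABN => /= h; exact/Bw/h.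
Qed.

Lemma measure_ae_eq (A B : set T) : measurable A -> measurable B ->
  {ae mu, forall w, A w <-> B w} -> mu A = mu B.
Proof.
move=> mA mB AB; apply/eqP; rewrite eq_le; apply/andP; split;
  apply: measure_ae_le => //; apply: filterS AB => w [] //.
Qed.

End almost_everywhere.

(** * The law of the degree of a fixed vertex *)

Section degree_law_of_process.
Context d (T : measurableType d) (R : realType) (P : probability T R).
Variable G : nat -> {RV P >-> hgraph}.
Hypothesis hG : linear_depreferential_attachment G.
Variable i : nat.
Hypothesis hi : (1 <= i)%N.

Let deg n w := degree i (G n w).
Let Deg n k := [set w | deg n w = k].

Let measurable_preimage n (A : set hgraph) : measurable (G n @^-1` A).
Proof. by rewrite -[X in measurable X]setTI; exact: measurable_funP. Qed.

Let measurable_Deg n k : measurable (Deg n k).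
Proof. exact: (measurable_preimage n [set g | degree i g = k]). Qed.

(** The event relates two random graphs; splitting by the value of [G n] gives a countable union. *)
Let measurable_attach n : measurable (attach_event G n i).
Proof.
have -> : attach_event G n i = \bigcup_g
    (G n @^-1` [set g] `&` G n.+1 @^-1` [set attach i g]).
  apply/seteqP; split => [w h|w [g _ [/= <-]]//].
  by exists (G n w).
apply: countable_bigcupT_measurable; first exact: countable_hgraph.
by move=> g; apply: measurableI; exact: measurable_preimage.
Qed.

(** A step adds one edge, hence at most 2 to any degree. The vertex count is tracked because it
    determines the label of the new vertex. *)
Let invariant n : (2 <= n)%N ->
  {ae P, forall w, nverts (G n w) = n /\ (deg n w <= n.*2)%N}.
Proof.
elim: n => // n ih; rewrite leq_eqVlt => /predU1P[<-|n2].
  apply: filterS (ldpa_init hG) => w.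
  rewrite /deg => -[] -> ; split => //; exact: degree_initial_graph_le.
apply: filterS2 (ih n2) (ldpa_step hG n2) => w [nv dn] [j jn].
rewrite /deg => ->; rewrite degree_attach/= nv; split => //.
rewrite doubleS -addn2 leq_add//.
by case: eqP => //; case: eqP.
Qed.

(** From this time on the process runs and the vertex [i] is present, so no new vertex is labelled
    [i]. *)
Let n0 := maxn 2 i.

Let step n : (n0 <= n)%N -> {ae P, forall w,
  (attach_event G n i w /\ deg n.+1 w = (deg n w).+1) \/
  (~ attach_event G n i w /\ deg n.+1 w = deg n w)}.
Proof.
rewrite geq_max => /andP[n2 ni].
apply: filterS2 (invariant n2) (ldpa_step hG n2) => w [nv dn] [j jn aw].
have dE : deg n.+1 w = (deg n w + (j == i))%N.
  by rewrite /deg aw degree_attach nv (_ : (n.+1 == i) = false)//; apply/eqP; lia.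
have [ji|ji] := eqVneq j i.
  by left; rewrite dE -ji eqxx addn1.
right; rewrite dE (negbTE ji) addn0; split => //.
by rewrite /attach_event/= aw => /attach_inj /eqP; rewrite (negbTE ji).
Qed.

Let f n k : R := fine (P (Deg n k)).

Let PE n k : P (Deg n k) = (f n k)%:E.
Proof. by rewrite /f fineK// fin_num_measure. Qed.

(** [Deg n k] belongs to the natural filtration and the conditional probability is constant on it;
    this closes the recursion of the marginal laws. *)
Let attach_Deg n k : (n0 <= n)%N ->
  P (attach_event G n i `&` Deg n k) = (f n k * attach_prob R n k)%:E.
Proof.
rewrite geq_max => /andP[n2 ni].
have hin : (1 <= i <= n)%N by rewrite hi.
have [_ _ ->] := ldpa_prob hG n2 hin; last first.
  apply: sub_sigma_algebra; exists n; first by rewrite /= n2 leqnn.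
  by exists [set g | degree i g = k] => //; rewrite setTI.
rewrite (eq_integral (cst (attach_prob R n k)%:E)); last first.
  by move=> w; rewrite inE/= => dw; rewrite -/(deg n w) dw.
by rewrite integral_cst// [RHS]EFinM [RHS]muleC; congr (_ * _)%E; exact: PE.
Qed.

Let Deg_diff n k : (n0 <= n)%N ->
  P (Deg n k `\` attach_event G n i) = (f n k * (1 - attach_prob R n k))%:E.
Proof.
move=> n0n.
transitivity (P (Deg n k) - P (attach_event G n i `&` Deg n k))%E.
  rewrite setIC; apply: measureD => //.
  by rewrite (le_lt_trans (probability_le1 _ _))// ltry.
by rewrite attach_Deg// PE -EFinB mulrBr mulr1.
Qed.

(** A general [Q] serves both the total mass and the distribution function of the standardized
    degree. *)
Lemma sum_prob_degree n m (Q : pred nat) : (2 <= n)%N -> (n.*2 <= m)%N ->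
  P [set w | Q (deg n w)] = (\sum_(k < m.+1 | Q k) f n k)%:E.
Proof.
move=> n2 nm.
rewrite -sumEFin; under eq_bigr do rewrite -PE.
rewrite -measure_bigsetU_ord//; last first.
  by move=> j k _ _ [w [/= jw kw]]; apply/val_inj; rewrite /= -jw -kw.
apply: measure_ae_eq.
- exact: (measurable_preimage n [set g | Q (degree i g)]).
- exact: bigsetU_measurable.
rewrite -(bigcup_pred [pred k : 'I_m.+1 | Q k] (fun k => Deg n k)).
apply: filterS (invariant n2) => w [_ dn].
split=> [Qw|[k /= Qk ->]//].
have dm : (deg n w < m.+1)%N by rewrite ltnS (leq_trans dn).
by exists (Ordinal dm).
Qed.

(** For the recursion, [Deg n.+1 k.+1] is almost everywhere the disjoint union of [Deg n k] with an
    attachment to [i] and [Deg n k.+1] without one. *)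
Lemma degree_law_process : degree_law f n0.
Proof.
split.
- by rewrite leq_max.
- by move=> n k; rewrite fine_ge0.
- move=> n k; rewrite geq_max => /andP[n2 _] nk.
  suff : P (Deg n k) = 0%E by rewrite /f => ->.
  rewrite -(measure0 P); apply: measure_ae_eq => //.
  apply: filterS (invariant n2) => w [_ dn]; split => //= dk.
  by move: nk; rewrite -dk ltnNge dn.
- move=> n m; rewrite geq_max => /andP[n2 _] nm.
  apply: EFin_inj; rewrite -(sum_prob_degree xpredT n2 nm).
  by rewrite -(probability_setT P); congr (P _); apply/seteqP; split.
- move=> n n0n; apply: EFin_inj; rewrite -PE -Deg_diff//.
  apply: measure_ae_eq => //; first exact: measurableD.
  apply: filterS (step n0n) => w; rewrite /Deg/=.
  by case=> -[aw ->]; split => // -[].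
- move=> n k n0n; apply: EFin_inj; rewrite EFinD -PE -Deg_diff// -attach_Deg//.
  rewrite -measureU//; first last.
  + by rewrite -subset0 => w [[aw _] [_ /(_ aw)]].
  + exact: measurableD.
  + exact: measurableI.
  apply: measure_ae_eq => //.
    by apply: measurableU; [exact: measurableI|exact: measurableD].
  apply: filterS (step n0n) => w; rewrite /Deg/=.
  case=> -[aw ->]; split.
  + by move=> [dw]; left.
  + by case=> -[// _ ->].
  + by move=> dw; right.
  + by case=> -[].
Qed.

End degree_law_of_process.

Theorem theorem2p2 (d : measure_display) (T : measurableType d) (R : realType)
  (P : probability T R) (G : nat -> {RV P >-> hgraph})
  (hG : linear_depreferential_attachment G) (i : nat) (hi : (1 <= i)%N) :
  cvg_in_distribution
    (fun n => (normalized_degree R i n \o G n)%FUN : {RV P >-> R})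
    (normal_prob 0%R 1%R).
Proof.
move=> x _; rewrite [X in _ --> X](std_cdf_itv x : _ = _).
have h := @dlaw_clt _ _ _ (degree_law_process hG hi) x.
apply: cvg_EFin; first by apply: nearW => n; exact: fin_num_measure.
apply: cvg_trans h; apply: near_eq_cvg; near=> n.
(* From time 2 on, the distribution function is the finite sum of [dlaw_clt], with degrees running
   up to 2n + 1. *)
have n2 : (2 <= n)%N by near: n; exact: nbhs_infty_ge.
have := sum_prob_degree hG i (fun k => standardize R n k <= x) n2 (leqnSn _).
move=> /(congr1 fine)/= <-; congr (fine (P _)).
Unshelve. all: by end_near. Qed.
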